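(* Let $R$ be a commutative ring with identity and $S\subseteq R$ a multiplicative set such that $R$ is $S$-Noetherian. Then every proper ideal of $R$ disjoint from $S$ can be written as a finite intersection of $S$-primary ideals of $R$.
   Context: A multiplicative set $S\subseteq R$ contains $1$ and is closed under multiplication. $R$ is $S$-Noetherian if for each ideal $I$ of $R$ there exist $s\in S$ and a finitely generated ideal $J$ of $R$ with $sI\subseteq J\subseteq I$. An ideal $Q$ of $R$ with $Q\cap S=\emptyset$ is $S$-primary if there exists $s\in S$ such that for all $a,b\in R$ with $ab\in Q$, we have $sa\in Q$ or $sb\in \mathrm{rad}(Q)$, where $\mathrm{rad}(Q)=\{x\in R\mid x^n\in Q \text{ for some } n>0\}$. *)

(* Defs.v *)
From HB Require Import structures.
From mathcomp Require Import all_boot all_order all_algebra.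
From mathcomp Require Import boolp classical_sets cardinality.

Set Implicit Arguments.
Unset Strict Implicit.
Unset Printing Implicit Defensive.

Import GRing.Theory.
Local Open Scope classical_set_scope.
Local Open Scope ring_scope.

(* Subsets of the ring are arbitrary [set R], since [idealr] in [ring_quotient]
   is restricted to proper ideals of nontrivial rings and would exclude the
   unit ideal, which is allowed below. *)
Definition is_ideal (R : comPzRingType) (I : set R) : Prop :=
  [/\ I 0,
      forall x y, I x -> I y -> I (x + y)
    & forall a x, I x -> I (a * x)].

Definition finitely_generated_ideal (R : comPzRingType) (J : set R) : Prop :=
  exists2 G : set R, finite_set G & J = smallest (@is_ideal R) G.

Definition S_Noetherian (R : comPzRingType) (S : set R) : Prop :=
  forall I : set R, is_ideal I ->
    exists s : R, exists J : set R,
      [/\ S s,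
          finitely_generated_ideal J,
          [set s * x | x in I] `<=` J
        & J `<=` I].

Definition radical (R : comPzRingType) (Q : set R) : set R :=
  [set x | exists2 n : nat, (0 < n)%N & Q (x ^+ n)].

Definition S_primary (R : comPzRingType) (S Q : set R) : Prop :=
  [/\ is_ideal Q,
      Q `&` S = set0
    & exists2 s : R, S s &
        forall a b : R, Q (a * b) -> Q (s * a) \/ radical Q (s * b)].

(* Main.v *)
(* Saturated ideals (those equal to their own S-saturation) satisfy the
   ascending chain condition, so as in Lasker-Noether the saturation of I is a
   finite intersection of primary ideals P_i disjoint from S.  A single u in S
   multiplies the saturation of I into I, whence I is the intersection of its
   saturation with I + uR, that is, of the ideals P_i `&` (I + uR).  Each of
   these lies between u P_i and P_i, and is therefore S-primary. *)
Require Import Defs.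
From mathcomp Require Import all_boot all_order all_algebra.
From mathcomp Require Import boolp classical_sets cardinality.
From mathcomp Require Import ring.

Set Implicit Arguments.
Unset Strict Implicit.
Unset Printing Implicit Defensive.

Import GRing.Theory.
Local Open Scope classical_set_scope.
Local Open Scope ring_scope.

(** * Colon ideals, sums with a principal ideal, unions of chains *)

Section Ideals.
Context {R : comPzRingType}.
Implicit Types (I J K : set R) (u a b : R).

Definition colon I u : set R := [set x | I (u * x)].

Definition add_principal I u : set R :=
  [set x | exists2 i, I i & exists r, x = i + u * r].

Lemma colon_ideal I u : is_ideal I -> is_ideal (colon I u).
Proof.
move=> [I0 ID IM]; split=> [|x y|a x]; rewrite /colon /= ?mulr0 ?mulrDr //.
- exact: ID.
- by rewrite mulrCA; exact: IM.
Qed.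

Lemma sub_colon I u : is_ideal I -> I `<=` colon I u.
Proof. by move=> [_ _ IM] x /IM; apply. Qed.

Lemma add_principal_ideal I u : is_ideal I -> is_ideal (add_principal I u).
Proof.
move=> [I0 ID IM]; split=> [|_ _ [i Ii [r ->]] [j Ij [s ->]]|a _ [i Ii [r ->]]].
- by exists 0 => //; exists 0; rewrite mulr0 addr0.
- by exists (i + j); [exact: ID | exists (r + s); ring].
- by exists (a * i); [exact: IM | exists (a * r); ring].
Qed.

Lemma sub_add_principal I u : I `<=` add_principal I u.
Proof. by move=> x Ix; exists x => //; exists 0; rewrite mulr0 addr0. Qed.

Lemma mem_add_principal I u r : is_ideal I -> add_principal I u (u * r).
Proof. by move=> [I0 _ _]; exists 0 => //; exists r; rewrite add0r. Qed.

Lemma setI_ideal I J : is_ideal I -> is_ideal J -> is_ideal (I `&` J).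
Proof.
move=> [I0 ID IM] [J0 JD JM]; split=> // [x y [Ix Jx] [Iy Jy]|a x [Ix Jx]].
- by split; [exact: ID | exact: JD].
- by split; [exact: IM | exact: JM].
Qed.

Lemma colon_exp_sub I a m n : is_ideal I -> (m <= n)%N ->
  colon I (a ^+ m) `<=` colon I (a ^+ n).
Proof.
move=> [_ _ IM] /subnK <- x Ix; rewrite /colon /= exprD -mulrA; exact: IM.
Qed.

Lemma bigcup_chain_ideal (F : set (set R)) :
  F !=set0 -> (forall X, F X -> is_ideal X) -> total_on F subset ->
  is_ideal (\bigcup_(X in F) X).
Proof.
move=> [X0 FX0] Fid Ftot; split=> [|x y [X FX Xx] [Y FY Yy]|a x [X FX Xx]].
- by exists X0 => //; case: (Fid _ FX0).
- have [XY|YX] := Ftot _ _ FX FY.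
  + by exists Y => //; case: (Fid _ FY) => _ YD _; apply: YD => //; exact: XY.
  + by exists X => //; case: (Fid _ FX) => _ XD _; apply: XD => //; exact: YX.
- by exists X => //; case: (Fid _ FX) => _ _; apply.
Qed.

Lemma finite_sub_chain (F : set (set R)) (G : set R) :
  F !=set0 -> total_on F subset -> finite_set G ->
  G `<=` \bigcup_(X in F) X -> exists2 X, F X & G `<=` X.
Proof.
move=> [X0 FX0] Ftot /finite_seqP[s ->]; elim: s => [|g s IHs] sF.
  by exists X0 => // x; rewrite /= in_nil.
have [X FX gX] : (\bigcup_(X in F) X) g by apply: sF; rewrite /= mem_head.
have [|Y FY sY] := IHs; first by move=> x xs; apply: sF; rewrite /= in_cons xs orbT.
have [XY|YX] := Ftot _ _ FX FY.
- exists Y => // x; rewrite /= in_cons => /orP[/eqP->|]; first exact: XY.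
  exact: sY.
- exists X => // x; rewrite /= in_cons => /orP[/eqP->//|xs].
  exact/YX/sY.
Qed.

End Ideals.

(** * Saturation with respect to [S] and decomposition of saturated ideals *)

Section SNoetherian.
Context {R : comPzRingType} (S : set R).
Implicit Types (I J K Q : set R).

(** For an ideal [I] and multiplicative [S], this is the contraction to [R] of the extension of [I]
    to the localization of [R] at [S]. *)
Definition saturation I : set R := [set x | exists2 s, S s & I (s * x)].

Definition saturated_ideal K := is_ideal K /\ saturation K `<=` K.

Definition primary_disjoint Q :=
  [/\ is_ideal Q, Q `&` S = set0 &
      forall a b, Q (a * b) -> Q a \/ radical Q b].

(** The family may be empty, so the unit ideal counts as decomposable. *)
Definition decomposable K :=
  exists2 F : set (set R), finite_set F &
    F `<=` primary_disjoint /\ K = \bigcap_(X in F) X.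

Lemma decomposable_setI I J :
  decomposable I -> decomposable J -> decomposable (I `&` J).
Proof.
move=> [F Ffin [FP ->]] [G Gfin [GP ->]]; exists (F `|` G).
  by rewrite finite_setU.
by split; [move=> X [/FP|/GP] | rewrite bigcap_setU].
Qed.

Hypothesis S_mult : GRing.mulr_closed [in S].

Let S1 : S 1.
Proof. by case: S_mult => /set_mem. Qed.

Let SM s t : S s -> S t -> S (s * t).
Proof. by move=> Ss St; apply/set_mem; apply: S_mult.2; exact: mem_set. Qed.

Lemma sub_saturation I : I `<=` saturation I.
Proof. by move=> x Ix; exists 1; rewrite ?mul1r. Qed.

Lemma saturation_saturated I : is_ideal I -> saturated_ideal (saturation I).
Proof.
move=> [I0 ID IM]; split; first split.
- exact: sub_saturation.
- move=> x y [s Ss sx] [t St ty]; exists (s * t); first exact: SM.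
  have -> : s * t * (x + y) = t * (s * x) + s * (t * y) by ring.
  by apply: ID; exact: IM.
- move=> a x [s Ss sx]; exists s => //; rewrite mulrCA; exact: IM.
- move=> x [s Ss [t St tsx]]; exists (t * s); first exact: SM.
  by rewrite -mulrA.
Qed.

Lemma colon_saturated K u : saturated_ideal K -> saturated_ideal (colon K u).
Proof.
move=> [Kid Ksat]; split; first exact: colon_ideal.
by move=> x [s Ss usx]; apply: Ksat; exists s => //; rewrite mulrCA.
Qed.

Hypothesis S_noeth : S_Noetherian S.

(** Some [s] in [S] carries the saturation into a finitely generated ideal contained in it. Each
    generator has its own denominator; their product [t] serves all of them, and [t * s] is the
    uniform one. *)
Lemma saturation_denominator I : is_ideal I ->
  exists2 u, S u & forall x, saturation I x -> I (u * x).
Proof.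
move=> Iid; have [_ _ IM] := Iid.
have [satid _] := saturation_saturated Iid.
have [s [_ [Ss [G Gfin ->] sI GI]]] := S_noeth satid.
have {}GI : G `<=` saturation I by apply: subset_trans GI; exact: sub_gen_smallest.
have [t St tG] : exists2 t, S t & G `<=` colon I t.
  move: Gfin GI => /finite_seqP[l ->]; elim: l => [|g l IHl] lI {sI}.
    by exists 1 => // x; rewrite /= in_nil.
  have [s' Ss' s'g] : saturation I g by apply: lI; rewrite /= mem_head.
  have [|t St tl] := IHl.
    by move=> x xl; apply: lI; rewrite /= in_cons xl orbT.
  exists (t * s'); first exact: SM.
  move=> x; rewrite /= in_cons /colon /= => /orP[/eqP->|xl].
    by rewrite -mulrA; exact: IM.
  by rewrite (mulrC t) -mulrA; apply/IM/tl.
exists (t * s); first exact: SM.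
move=> x Ix; rewrite -mulrA.
apply: (smallest_sub (colon_ideal t Iid) tG).
by apply: sI; exists x.
Qed.

(** Some [s] in [S] carries the union into a finitely generated ideal whose generators already lie
    in one member [X]. Since [X] is saturated, [s] cancels and the union is [X]. *)
Lemma saturated_chain_max (F : set (set R)) :
  F !=set0 -> F `<=` saturated_ideal -> total_on F subset ->
  F (\bigcup_(X in F) X).
Proof.
move=> F0 Fsat Ftot.
have Uid : is_ideal (\bigcup_(X in F) X).
  by apply: bigcup_chain_ideal => // X /Fsat[].
have [s [_ [Ss [G Gfin ->] sU GU]]] := S_noeth Uid.
have [X FX GX] : exists2 X, F X & G `<=` X.
  by apply: finite_sub_chain => //; apply: subset_trans GU; exact: sub_gen_smallest.
have [Xid Xsat] := Fsat _ FX.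
suff -> : \bigcup_(X in F) X = X by [].
apply/seteqP; split=> [x Ux|]; last exact: bigcup_sup.
apply: Xsat; exists s => //; apply: (smallest_sub Xid GX).
by apply: sU; exists x.
Qed.

Lemma colon_exp_stable K b : saturated_ideal K ->
  exists n, forall m, colon K (b ^+ m) `<=` colon K (b ^+ n).
Proof.
move=> Ksat; have [Kid _] := Ksat.
have [||X Y [m _ <-] [n _ <-]|n _ nU] :=
  @saturated_chain_max (range (fun n => colon K (b ^+ n))).
- by exists (colon K (b ^+ 0)), 0%N.
- by move=> _ [n _ <-]; exact: colon_saturated.
- by have [/colon_exp_sub|/ltnW/colon_exp_sub] := leqP m n; [left|right]; auto.
- by exists n => m; rewrite nU => x Kx; exists (colon K (b ^+ m)) => //; exists m.
Qed.

(* Fitting-type splitting, replacing the usual detour through irreducible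
   ideals. *)
Lemma colon_split K b n : saturated_ideal K ->
  colon K (b ^+ (n + n)) `<=` colon K (b ^+ n) ->
  K = colon K (b ^+ n) `&` saturation (add_principal K (b ^+ n)).
Proof.
move=> [Kid Ksat] stab; have [_ KD KM] := Kid; apply/seteqP; split=> [x Kx|x].
  by split; [exact: sub_colon | exact/sub_saturation/sub_add_principal].
case=> bx [s Ss [k Kk [r sx]]].
apply: Ksat; exists s => //; rewrite sx; apply: (KD) => //.
(* What is left is [K (b ^+ n * r)]; by stability it suffices to multiply [r] by [b ^+ n] twice,
   which brings in the known [K (b ^+ n * x)]. *)
apply: stab; rewrite /colon /= exprD.
have -> : b ^+ n * b ^+ n * r = s * (b ^+ n * x) + (- b ^+ n) * k.
  by rewrite mulrCA sx; ring.
by apply: KD; exact: KM.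
Qed.

(** Noetherian induction: a maximal saturated counterexample [M] is neither the unit ideal nor
    primary, so it splits into two strictly larger saturated ideals, which are decomposable. *)
Lemma saturated_decomposable K : saturated_ideal K -> decomposable K.
Proof.
move=> Ksat; apply: contrapT => Kbad.
pose bad X := saturated_ideal X /\ ~ decomposable X.
(* [set0] is only there to accommodate the empty chain. *)
have [F Fbad Ftot|M [Mbad Mmax]] := @Zorn_bigcup _ (set0 |` bad).
  have [F0|F0] := pselect (F `&` bad !=set0); last first.
    left; apply: bigcup0 => X FX; have [//|Xbad] := Fbad _ FX.
    by exfalso; apply: F0; exists X.
  right; have -> : \bigcup_(X in F) X = \bigcup_(X in F `&` bad) X.
    apply/seteqP; split=> [x [X FX Xx]|x [X [FX _] Xx]]; last by exists X.
    by have [X0|Xbad] := Fbad _ FX; [rewrite X0 in Xx | exists X].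
  suff [] : (F `&` bad) (\bigcup_(X in F `&` bad) X) by [].
  apply: saturated_chain_max => // [X [_ []]//|X Y [FX _] [FY _]].
  exact: Ftot.
have {Mbad} [M0|[Msat Mndec]] := Mbad.
  (* The empty set is not maximal, as [K] is bad and contains 0. *)
  apply: (Mmax K); last by right.
  by rewrite M0; split=> // K0; case: Ksat => -[/K0].
have above J x : saturated_ideal J -> M `<=` J -> J x -> ~ M x -> decomposable J.
  move=> Jsat MJ Jx Mx; apply: contrapT => Jndec; apply: (Mmax J); last by right.
  by split=> // JM; apply/Mx/JM.
have [Mid Msub] := Msat.
apply: Mndec; have [[t [Mt St]]|MS] := pselect (M `&` S !=set0).
  (* A saturated ideal meeting [S] is all of [R], the empty intersection. *)
  exists set0 => //; split=> //; rewrite bigcap_set0; apply/seteqP; split=> // x _.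
  by apply: Msub; exists t => //; case: Mid => _ _ MM; rewrite mulrC; exact: MM.
have [Mprim|] := pselect (forall a b, M (a * b) -> M a \/ radical M b).
  exists [set M] => //; split; last by rewrite bigcap_set1.
  by move=> _ ->; split=> //; apply/seteqP; split=> // x ?; apply: MS; exists x.
move=> /existsNP[a /existsNP[b /not_implyP[Mab /not_orP[Ma Mb]]]].
have [n stab] := colon_exp_stable b Msat.
(* The exponent becomes [n.+1] because [radical] asks for a positive power. *)
have {}stab m : colon M (b ^+ m) `<=` colon M (b ^+ n.+1).
  by move=> x /stab; apply: colon_exp_sub.
rewrite (colon_split Msat (stab _)); apply: decomposable_setI.
(* Both factors exceed [M]: the first contains [a], the second [b ^+ n.+1]. *)
- apply: (above _ a) => //; first exact: colon_saturated.
    exact: sub_colon.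
  by apply: (stab 1%N); rewrite /colon /= mulrC.
- apply: (above _ (b ^+ n.+1)).
  + exact/saturation_saturated/add_principal_ideal.
  + by move=> x Mx; exact/sub_saturation/sub_add_principal.
  + by apply: sub_saturation; rewrite -[X in _ X]mulr1; exact: mem_add_principal.
  + by move=> Mbn; apply: Mb; exists n.+1.
Qed.

(** The witness is [u]: if [P a] then [Q (u * a)], and if [P (b ^+ n.+1)] then the power
    [(u * b) ^+ n.+1] is [u ^+ n] times an element of [u P], hence in [Q]. *)
Lemma primary_between_S_primary P Q u : primary_disjoint P -> S u ->
  is_ideal Q -> Q `<=` P -> (forall x, P x -> Q (u * x)) -> S_primary S Q.
Proof.
move=> [_ PS Pprim] Su Qid QP uPQ; split=> //.
  by apply/seteqP; split=> // x [/QP Px Sx]; rewrite -PS.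
exists u => // a b /QP/Pprim[/uPQ|[[//|n] _ Pbn]]; [by left|right].
exists n.+1 => //; rewrite exprMn exprS -mulrA mulrCA.
by case: Qid => _ _ QM; apply/QM/uPQ.
Qed.

End SNoetherian.

Theorem theorem9 (R : comPzRingType) (S : set R)
    (S_mult : GRing.mulr_closed [in S]) (S_noeth : S_Noetherian S)
    (I : set R) (I_ideal : is_ideal I) (I_proper : I <> [set: R])
    (I_disj : I `&` S = set0) :
  exists (n : nat) (Q : 'I_n.+1 -> set R),
    (forall i, S_primary S (Q i)) /\ I = \bigcap_i Q i.
Proof.
have [_ ID IM] := I_ideal.
have [u Su uI] := saturation_denominator S_mult S_noeth I_ideal.
have [F /finite_seqP[l ->] [lP satE]] := saturated_decomposable S_mult S_noeth
  (saturation_saturated S_mult I_ideal).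
have satI x : saturation S I x <-> forall X, X \in l -> X x.
  by rewrite satE.
have IE x : I x <-> saturation S I x /\ add_principal I u x.
  split=> [Ix|[Sx [i Ii [r xE]]]].
    by split; [exact: sub_saturation | exact: sub_add_principal].
  (* As [u * x] and [u * i] lie in [I], so does [u * u * r]; hence [r] is in the saturation and
     [u * r] in [I]. *)
  rewrite xE; apply: (ID) => //; apply: (uI); exists (u * u).
    by apply/set_mem; apply: S_mult.2; exact: mem_set.
  have -> : u * u * r = u * x + (- u) * i by rewrite xE; ring.
  by apply: ID; [exact: uI | exact: IM].
(* With no components the saturation would be [R], putting [u] in both [I] and [S]. *)
case: l => [|P l] in lP satE satI *.
  have : (I `&` S) u.
    by split=> //; rewrite -[u]mulr1; apply: uI; apply/satI => X; rewrite in_nil.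
  by rewrite I_disj.
exists (size l), (fun i => nth P (P :: l) i `&` add_principal I u); split=> [i|].
  have Pi : nth P (P :: l) i \in P :: l by rewrite mem_nth.
  have Pprim := lP _ Pi; have [Pid _ _] := Pprim.
  apply: (primary_between_S_primary Pprim Su).
  - exact: setI_ideal (add_principal_ideal _ _).
  - by move=> x [].
  - move=> x Px; split; last exact: mem_add_principal.
    by case: Pid => _ _; apply.
apply/seteqP; split=> [x /IE[/satI xl Ax] i _|x xQ].
  by split=> //; apply: xl; rewrite mem_nth.
apply/IE; split; last by have [] := xQ ord0.
apply/satI => X Xl; rewrite -(nth_index P Xl).
by have [] := xQ (Ordinal (n := (size l).+1) (m := index X (P :: l))
  (etrans (index_mem _ _) Xl)) Logic.I.
Qed.
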